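(* For a positive integer $m$ and a positive integer $\ell<m/2$, the following identities hold true: (i) for $m$ divisible by $4$ and $\ell$ odd, $$\frac{F_{\frac{3m}{2}-3\ell-1}}{F_{\frac{3m}{2}}}=\frac{L_{3m-3\ell}+L_{3\ell}}{L_{3m}-2};$$ (ii) for $m$ divisible by $4$ and $\ell$ even, $$\frac{\mathrm{cFh}\left(\frac{3m-6\ell-2}{4}\right)}{F_{\frac{3m}{2}}}=\frac{\sqrt{5}\left(F_{3m-3\ell}+F_{3\ell}\right)}{L_{3m}-2};$$ (iii) for $m$ even and not divisible by $4$ and $\ell$ even, $$\frac{F_{\frac{3m}{2}-3\ell-1}}{\mathrm{sFh}\left(\frac{3m}{4}\right)}=\frac{\sqrt{5}\left(F_{3m-3\ell}+F_{3\ell}\right)}{L_{3m}-2};$$ (iv) $$\frac{\mathrm{cFh}\left(\frac{3m-6\ell-2}{4}\right)}{\mathrm{sFh}\left(\frac{3m}{4}\right)}=\begin{cases}\dfrac{\sqrt{5}F_{3m-3\ell}+L_{3\ell}}{\sqrt{5}F_{3m}-2}, & m \text{ not divisible by } 4,\ \ell \text{ odd},\\[2ex] \dfrac{L_{3m-3\ell}+\sqrt{5}F_{3\ell}}{\sqrt{5}F_{3m}-2}, & m \text{ odd},\ \ell \text{ even}.\end{cases}$$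
   Context: $F_n$ and $L_n$ are the Fibonacci and Lucas numbers: $F_0=0$, $F_1=1$, $F_n=F_{n-1}+F_{n-2}$ and $L_0=2$, $L_1=1$, $L_n=L_{n-1}+L_{n-2}$ for $n\ge 2$. With $\phi=\frac{1+\sqrt5}{2}$, the Fibonacci hyperbolic sine and cosine functions are defined for real $x$ by $$\mathrm{sFh}(x)=\frac{\phi^{2x}-\phi^{-2x}}{\sqrt5},\qquad \mathrm{cFh}(x)=\frac{\phi^{2x+1}+\phi^{-(2x+1)}}{\sqrt5}.$$
   Formalization: The printed identities fail in places: the numerator in (i) and (iii) is corrected to F_{3m/2-3l}, and the first formula of (iv) is stated for m odd only, with (L_{3m-3l}+L_{3l})/(L_{3m}-2) as the value for m even, not divisible by 4, l odd. *)

(* Defs.v *)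
From Stdlib Require Import Reals Lra Lia Arith.

Open Scope R_scope.

Fixpoint fib (n : nat) : nat :=
  match n with
  | O => 0
  | S p => match p with
           | O => 1
           | S q => fib p + fib q
           end
  end%nat.

Fixpoint lucas (n : nat) : nat :=
  match n with
  | O => 2
  | S p => match p with
           | O => 1
           | S q => lucas p + lucas q
           end
  end%nat.

(* Real-valued versions, since the identities involve quotients and [sqrt 5]. *)
Definition F (n : nat) : R := INR (fib n).
Definition L (n : nat) : R := INR (lucas n).

Definition phi : R := (1 + sqrt 5) / 2.

Definition sFh (x : R) : R :=
  (Rpower phi (2 * x) - Rpower phi (- (2 * x))) / sqrt 5.

Definition cFh (x : R) : R :=
  (Rpower phi (2 * x + 1) + Rpower phi (- (2 * x + 1))) / sqrt 5.

(* The source prints [F_(3m/2 - 3l - 1)] in the numerators of (i) and (iii).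
   With F_0 = 0 and F_1 = 1 this fails: for (m, l) = (4, 1) the two sides of
   (i) are 1/8 and 1/4, and for (m, l) = (6, 2) those of (iii) are
   sqrt 5 / 76 and sqrt 5 / 38.  The index that agrees with
   [cFh ((3m - 6l - 2) / 4)] in (ii) and (iv), since
   cFh ((n - 2) / 4) = F_(n/2) for n/2 odd, is 3m/2 - 3l, used in the theorem.

   The source also asserts the first formula of (iv) for every [m] not
   divisible by 4 and [l] odd.  It holds for [m] odd only: at (m, l) = (6, 1)
   the left side is 9/38 while the right side is
   (610 sqrt 5 + 4) / (2584 sqrt 5 - 2).  For [m] even and not divisible by 4
   the value is (L_(3m-3l) + L_(3l)) / (L_(3m) - 2), stated as a separate
   case.

   In (i)-(iii) [m] is even, so [3 * m / 2] is an exact division of naturals,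
   and 2l < m keeps every natural subtraction away from truncation. *)

(* Main.v *)
(* Put s(x) = phi^x - phi^(-x) and c(x) = phi^x + phi^(-x).  By Binet, sqrt 5 F_n
   is s(n) for n even and c(n) for n odd, while L_n is c(n) for n even and s(n)
   for n odd.  With x = 3m/2 and y = 3l every case becomes
   c(x - y) / s(x) = (s(2x - y) + s(y)) / (c(2x) - 2), which follows from
   c(x - y) s(x) = s(2x - y) + s(y) and s(x)^2 = c(2x) - 2. *)
Require Import Defs.
From Stdlib Require Import Reals Arith Lra Lia.
Open Scope R_scope.

(** The functions s and c, i.e. 2 sinh and 2 cosh of [x * ln phi]. They take real arguments because
    3m/2 is a half-integer for odd m. *)
Definition phi_diff (x : R) : R := Rpower phi x - Rpower phi (- x).
Definition phi_sum (x : R) : R := Rpower phi x + Rpower phi (- x).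

Lemma sqrt5_sqr : sqrt 5 * sqrt 5 = 5.
Proof. apply sqrt_sqrt; lra. Qed.

Lemma sqrt5_pos : 0 < sqrt 5.
Proof. apply sqrt_lt_R0; lra. Qed.

Lemma phi_gt1 : 1 < phi.
Proof. pose proof sqrt5_sqr; pose proof sqrt5_pos; unfold phi; nra. Qed.

Lemma phi_sqr : phi * phi = phi + 1.
Proof. pose proof sqrt5_sqr; unfold phi; nra. Qed.

Lemma inv_phi : / phi = phi - 1.
Proof.
  pose proof phi_sqr; pose proof phi_gt1.
  apply (Rmult_eq_reg_l phi); [| lra].
  rewrite Rinv_r by lra; lra.
Qed.

Lemma fib_SS n : F (S (S n)) = F (S n) + F n.
Proof. exact (plus_INR (fib (S n)) (fib n)). Qed.

Lemma lucas_SS n : L (S (S n)) = L (S n) + L n.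
Proof. exact (plus_INR (lucas (S n)) (lucas n)). Qed.

Lemma pow_SS_fib x n : x * x = x + 1 -> x ^ S (S n) = x ^ S n + x ^ n.
Proof.
  intro H; simpl.
  replace (x * (x * x ^ n)) with (x * x * x ^ n) by ring.
  rewrite H; ring.
Qed.

(** [- / phi] is the conjugate (1 - sqrt 5)/2, the other root of x^2 = x + 1. Written this way, its
    n-th power is phi^(-n) up to the sign (-1)^n. *)
Lemma conj_phi_sqr : - / phi * - / phi = - / phi + 1.
Proof. rewrite inv_phi; pose proof phi_sqr; lra. Qed.

(** Both sides satisfy the Fibonacci recurrence, which reaches back two steps, hence strong
    induction. *)
Lemma binet_fib n : sqrt 5 * F n = phi ^ n - (- / phi) ^ n.
Proof.
  induction n as [n IH] using lt_wf_ind; destruct n as [| [| n]].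
  - unfold F; simpl; ring.
  - unfold F; simpl; rewrite inv_phi; unfold phi; lra.
  - rewrite fib_SS, Rmult_plus_distr_l, !IH by lia.
    rewrite (pow_SS_fib phi) by exact phi_sqr.
    rewrite (pow_SS_fib (- / phi)) by exact conj_phi_sqr.
    ring.
Qed.

Lemma binet_lucas n : L n = phi ^ n + (- / phi) ^ n.
Proof.
  induction n as [n IH] using lt_wf_ind; destruct n as [| [| n]].
  - unfold L; simpl; ring.
  - unfold L; simpl; rewrite inv_phi; lra.
  - rewrite lucas_SS, !IH by lia.
    rewrite (pow_SS_fib phi) by exact phi_sqr.
    rewrite (pow_SS_fib (- / phi)) by exact conj_phi_sqr.
    ring.
Qed.

Lemma Rpower_phi_INR n : Rpower phi (INR n) = phi ^ n.
Proof. apply Rpower_pow; pose proof phi_gt1; lra. Qed.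

Lemma conj_phi_pow_even n :
  Nat.Even n -> (- / phi) ^ n = Rpower phi (- INR n).
Proof.
  rewrite Rpower_Ropp, Rpower_phi_INR, <- pow_inv; intros [k ->].
  rewrite !pow_mult; f_equal; ring.
Qed.

Lemma conj_phi_pow_odd n :
  Nat.Odd n -> (- / phi) ^ n = - Rpower phi (- INR n).
Proof.
  rewrite Rpower_Ropp, Rpower_phi_INR, <- pow_inv; intros [k ->].
  rewrite !pow_add, !pow_mult.
  (* Squaring removes the sign; the single factor left over from the odd exponent supplies the
     minus. *)
  replace ((- / phi) ^ 2) with ((/ phi) ^ 2) by ring.
  ring.
Qed.

Lemma fib_even n : Nat.Even n -> sqrt 5 * F n = phi_diff (INR n).
Proof.
  intro H; unfold phi_diff.
  now rewrite binet_fib, conj_phi_pow_even, Rpower_phi_INR.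
Qed.

Lemma fib_odd n : Nat.Odd n -> sqrt 5 * F n = phi_sum (INR n).
Proof.
  intro H; unfold phi_sum.
  rewrite binet_fib, conj_phi_pow_odd, Rpower_phi_INR by assumption; ring.
Qed.

Lemma lucas_even n : Nat.Even n -> L n = phi_sum (INR n).
Proof.
  intro H; unfold phi_sum.
  now rewrite binet_lucas, conj_phi_pow_even, Rpower_phi_INR.
Qed.

Lemma lucas_odd n : Nat.Odd n -> L n = phi_diff (INR n).
Proof.
  intro H; unfold phi_diff.
  rewrite binet_lucas, conj_phi_pow_odd, Rpower_phi_INR by assumption; ring.
Qed.

Lemma sFh_phi_diff x : sqrt 5 * sFh x = phi_diff (2 * x).
Proof. pose proof sqrt5_pos; unfold sFh, phi_diff; field; lra. Qed.

Lemma cFh_phi_sum x : sqrt 5 * cFh x = phi_sum (2 * x + 1).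
Proof. pose proof sqrt5_pos; unfold cFh, phi_sum; field; lra. Qed.

(** The analogue of 2 cosh u sinh v = sinh(u + v) + sinh(v - u). *)
Lemma phi_sum_mul_diff u v :
  phi_sum u * phi_diff v = phi_diff (u + v) + phi_diff (v - u).
Proof.
  unfold phi_sum, phi_diff, Rminus.
  rewrite !Ropp_plus_distr, !Ropp_involutive, !Rpower_plus; ring.
Qed.

Lemma phi_diff_sqr x : phi_diff x * phi_diff x = phi_sum (2 * x) - 2.
Proof.
  (* The cross term of the square, which produces the -2. *)
  assert (H : Rpower phi x * Rpower phi (- x) = 1).
  { rewrite <- Rpower_plus, Rplus_opp_r; apply Rpower_O.
    pose proof phi_gt1; lra. }
  unfold phi_diff, phi_sum.
  replace (2 * x) with (x + x) by ring.
  rewrite Ropp_plus_distr, !Rpower_plus; lra.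
Qed.

Lemma phi_diff_pos x : 0 < x -> 0 < phi_diff x.
Proof.
  intro H; unfold phi_diff.
  assert (Rpower phi (- x) < Rpower phi x)
    by (apply Rpower_lt; [exact phi_gt1 | lra]).
  lra.
Qed.

Lemma phi_quotient x y :
  0 < x ->
  phi_sum (x - y) / phi_diff x
  = (phi_diff (2 * x - y) + phi_diff y) / (phi_sum (2 * x) - 2).
Proof.
  intro Hx; pose proof (phi_diff_pos x Hx).
  (* Extend the fraction by s(x) and use the product formula with u = x - y and v = x, so that v - u
     = y. *)
  replace (2 * x - y) with (x - y + x) by ring.
  replace (phi_diff y) with (phi_diff (x - (x - y))) by (f_equal; ring).
  rewrite <- phi_sum_mul_diff, <- phi_diff_sqr; field; lra.
Qed.

(** The common shape of all cases: [a] and [b] are values of [F], [cFh] or [sFh], each carrying a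
    factor sqrt 5 that cancels in the quotient. *)
Lemma quotient_of_phi_forms a b N D x y :
  0 < x ->
  sqrt 5 * a = phi_sum (x - y) -> sqrt 5 * b = phi_diff x ->
  N = phi_diff (2 * x - y) + phi_diff y -> D = phi_sum (2 * x) - 2 ->
  a / b = N / D.
Proof.
  intros Hx Ha Hb -> ->.
  pose proof sqrt5_pos; pose proof (phi_diff_pos x Hx).
  rewrite <- phi_quotient, <- Ha, <- Hb by exact Hx.
  (* [b] is nonzero since [sqrt 5 * b] equals s(x) > 0. *)
  field; split; nra.
Qed.

Theorem proposition5p5 :
  forall m l : nat, (0 < m)%nat -> (0 < l)%nat -> INR l < INR m / 2 ->
  (* (i) *)
  (Nat.divide 4 m -> Nat.Odd l ->
     F (3 * m / 2 - 3 * l) / F (3 * m / 2)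
     = (L (3 * m - 3 * l) + L (3 * l)) / (L (3 * m) - 2)) /\
  (* (ii) *)
  (Nat.divide 4 m -> Nat.Even l ->
     cFh ((3 * INR m - 6 * INR l - 2) / 4) / F (3 * m / 2)
     = sqrt 5 * (F (3 * m - 3 * l) + F (3 * l)) / (L (3 * m) - 2)) /\
  (* (iii) *)
  (Nat.Even m -> ~ Nat.divide 4 m -> Nat.Even l ->
     F (3 * m / 2 - 3 * l) / sFh (3 * INR m / 4)
     = sqrt 5 * (F (3 * m - 3 * l) + F (3 * l)) / (L (3 * m) - 2)) /\
  (* (iv) *)
  (Nat.Odd m -> Nat.Odd l ->
     cFh ((3 * INR m - 6 * INR l - 2) / 4) / sFh (3 * INR m / 4)
     = (sqrt 5 * F (3 * m - 3 * l) + L (3 * l)) / (sqrt 5 * F (3 * m) - 2)) /\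
  (Nat.Even m -> ~ Nat.divide 4 m -> Nat.Odd l ->
     cFh ((3 * INR m - 6 * INR l - 2) / 4) / sFh (3 * INR m / 4)
     = (L (3 * m - 3 * l) + L (3 * l)) / (L (3 * m) - 2)) /\
  (Nat.Odd m -> Nat.Even l ->
     cFh ((3 * INR m - 6 * INR l - 2) / 4) / sFh (3 * INR m / 4)
     = (L (3 * m - 3 * l) + sqrt 5 * F (3 * l)) / (sqrt 5 * F (3 * m) - 2)).
Proof.
  intros m l Hm Hl Hlt.
  assert (Hlm : (2 * l < m)%nat)
    by (apply INR_lt; rewrite mult_INR; simpl; lra).
  set (x := 3 * INR m / 2); set (y := 3 * INR l).
  assert (Hx : 0 < x) by (apply lt_0_INR in Hm; unfold x; lra).
  assert (H3l : INR (3 * l) = y) by (rewrite mult_INR; simpl; unfold y; ring).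
  assert (H3m : INR (3 * m) = 2 * x)
    by (rewrite mult_INR; simpl; unfold x; field).
  assert (Hd : INR (3 * m - 3 * l) = 2 * x - y)
    by (rewrite minus_INR by lia; rewrite H3m, H3l; reflexivity).
  assert (Hh : Nat.Even m -> INR (3 * m / 2) = x).
  { intros [k ->].
    replace (3 * (2 * k))%nat with (3 * k * 2)%nat by ring.
    rewrite Nat.div_mul by lia.
    unfold x; rewrite !mult_INR; simpl; field. }
  assert (Hhd : Nat.Even m -> INR (3 * m / 2 - 3 * l) = x - y).
  { intro E; rewrite minus_INR; [now rewrite Hh, H3l |].
    apply Nat.div_le_lower_bound; lia. }
  (* The -2 in the argument offsets the +1 in [cFh]: 2(3m - 6l - 2)/4 + 1 = 3m/2 - 3l. *)
  assert (Hc : sqrt 5 * cFh ((3 * INR m - 6 * INR l - 2) / 4) = phi_sum (x - y))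
    by (rewrite cFh_phi_sum; f_equal; unfold x, y; field).
  assert (Hs : sqrt 5 * sFh (3 * INR m / 4) = phi_diff x)
    by (rewrite sFh_phi_diff; f_equal; unfold x; field).
  assert (H4 : Nat.divide 4 m -> Nat.Even m /\ Nat.Even (3 * m / 2)).
  { intros [k ->].
    replace (3 * (k * 4))%nat with (6 * k * 2)%nat by ring.
    rewrite Nat.div_mul by lia.
    split; [exists (2 * k)%nat | exists (3 * k)%nat]; ring. }
  assert (H2 : Nat.Even m -> ~ Nat.divide 4 m -> Nat.Odd (3 * m / 2)).
  { intros [k ->] N4.
    replace (3 * (2 * k))%nat with (3 * k * 2)%nat by ring.
    rewrite Nat.div_mul by lia.
    (* Here 3m/2 = 3k, and an even k would make 4 divide m. *)
    destruct (Nat.Even_or_Odd k) as [[j ->] | [j ->]].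
    - exfalso; apply N4; exists j; ring.
    - exists (3 * j + 1)%nat; ring. }
  assert (Hle : (3 * l <= 3 * m / 2)%nat)
    by (apply Nat.div_le_lower_bound; lia).
  repeat split.
  - intros Hm4 [k Hk]; destruct (H4 Hm4) as [[i Hi] [j Hj]].
    apply quotient_of_phi_forms with x y; try exact Hx.
    (* Even minus odd: 2j - 3(2k + 1) = 2(j - 3k - 2) + 1. *)
    + rewrite fib_odd by (exists (j - 3 * k - 2)%nat; lia).
      rewrite Hhd by (exists i; lia); reflexivity.
    + rewrite fib_even by (exists j; lia).
      rewrite Hh by (exists i; lia); reflexivity.
    + rewrite <- Hd, <- H3l; f_equal; apply lucas_odd.
      * exists (3 * i - 3 * k - 2)%nat; lia.
      * exists (3 * k + 1)%nat; lia.
    + rewrite <- H3m; f_equal; apply lucas_even; exists (3 * i)%nat; lia.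
  - intros Hm4 [k Hk]; destruct (H4 Hm4) as [[i Hi] [j Hj]].
    (* Now 3m/2 - 3l is even, so c(x - y) is given by [cFh] through [Hc] and not by a Fibonacci
       number. *)
    apply quotient_of_phi_forms with x y; try assumption.
    + rewrite fib_even by (exists j; lia).
      rewrite Hh by (exists i; lia); reflexivity.
    + rewrite Rmult_plus_distr_l, <- Hd, <- H3l; f_equal; apply fib_even.
      * exists (3 * i - 3 * k)%nat; lia.
      * exists (3 * k)%nat; lia.
    + rewrite <- H3m; f_equal; apply lucas_even; exists (3 * i)%nat; lia.
  - intros Hm2 Hm4 [k Hk]; destruct (H2 Hm2 Hm4) as [j Hj].
    destruct Hm2 as [i Hi].
    (* Now 3m/2 is odd, so s(x) comes from [sFh] through [Hs], while 3m/2 - 3l is odd and keeps [F]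
       in the numerator. *)
    apply quotient_of_phi_forms with x y; try assumption.
    + rewrite fib_odd by (exists (j - 3 * k)%nat; lia).
      rewrite Hhd by (exists i; lia); reflexivity.
    + rewrite Rmult_plus_distr_l, <- Hd, <- H3l; f_equal; apply fib_even.
      * exists (3 * i - 3 * k)%nat; lia.
      * exists (3 * k)%nat; lia.
    + rewrite <- H3m; f_equal; apply lucas_even; exists (3 * i)%nat; lia.
  - intros [i Hi] [k Hk].
    (* [Hc] and [Hs] settle the left side in all cases of (iv); on the right, the parities of 3m -
       3l, 3l and 3m choose between [L] and [sqrt 5 * F]. *)
    apply quotient_of_phi_forms with x y; try assumption.
    + rewrite <- Hd, <- H3l; f_equal.
      * apply fib_even; exists (3 * i - 3 * k)%nat; lia.
      * apply lucas_odd; exists (3 * k + 1)%nat; lia.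
    + rewrite <- H3m; f_equal; apply fib_odd; exists (3 * i + 1)%nat; lia.
  - intros [i Hi] _ [k Hk].
    apply quotient_of_phi_forms with x y; try assumption.
    + rewrite <- Hd, <- H3l; f_equal; apply lucas_odd.
      * exists (3 * i - 3 * k - 2)%nat; lia.
      * exists (3 * k + 1)%nat; lia.
    + rewrite <- H3m; f_equal; apply lucas_even; exists (3 * i)%nat; lia.
  - intros [i Hi] [k Hk].
    apply quotient_of_phi_forms with x y; try assumption.
    + rewrite <- Hd, <- H3l; f_equal.
      * apply lucas_odd; exists (3 * i + 1 - 3 * k)%nat; lia.
      * apply fib_even; exists (3 * k)%nat; lia.
    + rewrite <- H3m; f_equal; apply fib_odd; exists (3 * i + 1)%nat; lia.
Qed.
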